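(* Let $S$ be a Seidel matrix with $\lambda_{\min}(S)=-5$ and $\omega([S])=4$. Let $G$ be a graph in the switching class $[S]$ with $\omega(G)=4$, and let $B=\{x_1,x_2,x_3,x_4\}$ be the vertex set of a $4$-clique in $G$. If there exist $i\neq j$ and vertices $u\in\mathcal{P}_{\{x_i\}}$, $v\in\mathcal{P}_{\{x_j\}}$ with $u\sim v$, then $|\mathcal{P}_{\{x_k\}}|\leqslant19$ for each $k\in\{1,2,3,4\}\setminus\{i,j\}$.
   Context: All graphs are finite, simple, undirected. A Seidel matrix of order $n$ is a real symmetric $n\times n$ matrix with zero diagonal and off-diagonal entries in $\{\pm1\}$; its graph $G(S)$ has vertex set $\{1,\dots,n\}$ with $i\sim j$ iff $S_{ij}=-1$. For $U\subseteq\{1,\dots,n\}$ let $D_U$ be diagonal with $(D_U)_{ii}=1$ if $i\in U$, $-1$ otherwise; the switching class $[S]$ is the set of graphs $G(D_USD_U)$. The switching graph $\mathcal{Sw}(S)$ is $G(S')$ with $S'=\begin{pmatrix}S&-S+\mathbf{I}\\-S+\mathbf{I}&S\end{pmatrix}$, and $\omega([S]):=\omega(\mathcal{Sw}(S))$ (clique number). For a clique $B=\{x_1,\dots,x_4\}$ in $G$ and $U\subseteq B$, the pillar $\mathcal{P}_U$ is the set of vertices $y\notin B$ such that $y$ is adjacent to every vertex of $U$ and to no vertex of $B\setminus U$. $\lambda_{\min}$ is the smallest eigenvalue. *)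

(* Defs.v *)
From HB Require Import structures.
From mathcomp Require Import all_boot all_order all_algebra.
From mathcomp Require Import reals.

Set Implicit Arguments.
Unset Strict Implicit.
Unset Printing Implicit Defensive.

Import Order.TTheory GRing.Theory Num.Theory.
Local Open Scope ring_scope.

(* A graph on the vertex set T is given by its adjacency relation (rel T).
   The relations seidel_graph S below are symmetric and irreflexive whenever
   S is a Seidel matrix. *)

Section Graphs.
Variables (T : finType) (e : rel T).

Definition clique (A : {set T}) : bool :=
  [forall x in A, forall y in A, (x != y) ==> e x y].

Definition clique_number : nat := (\max_(A : {set T} | clique A) #|A|)%N.

(* Meant for U \subset B. *)
Definition pillar (B U : {set T}) : {set T} :=
  [set y | [&& y \notin B, [forall x in U, e y x]
             & [forall x in B :\: U, ~~ e y x]]].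

End Graphs.

Section Seidel.
Variables (R : realType) (n : nat).
Implicit Type S : 'M[R]_n.

Definition seidel S : Prop :=
  [/\ S^T = S, forall i, S i i = 0
    & forall i j, i != j -> S i j = 1 \/ S i j = -1].

Definition seidel_graph S : rel 'I_n := fun i j => S i j == -1.

Definition switching_mx (U : {set 'I_n}) : 'M[R]_n :=
  diag_mx (\row_i (if i \in U then 1 else -1)).

(* Graphs are compared extensionally, as adjacency relations. *)
Definition switching_class S (G : rel 'I_n) : Prop :=
  exists U : {set 'I_n},
    G =2 seidel_graph (switching_mx U *m S *m switching_mx U).

Definition is_lambda_min S (a : R) : Prop :=
  eigenvalue S a /\ forall b : R, eigenvalue S b -> a <= b.

End Seidel.

Definition switching_graph (R : realType) (n : nat) (S : 'M[R]_n) :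
    rel 'I_(n + n) :=
  seidel_graph (block_mx S (- S + 1%:M) (- S + 1%:M) S).

Definition switching_clique_number (R : realType) (n : nat) (S : 'M[R]_n) :
    nat :=
  clique_number (switching_graph S).

(* Main.v *)
(** After switching, S + 5I is the Gram matrix of vectors of norm 5 in which adjacency
    means inner product -1 and non-adjacency means +1.  Two adjacent vertices of the
    pillar over x_k, together with the negatives of the other three base vertices,
    would be five vectors with pairwise inner product -1, i.e. a 5-clique in the
    switching graph; hence the pillar is independent.  Projecting away the base turns
    its vertices into pairwise orthogonal vectors of norm 4, which have inner product
    2/3 or -4/3 with the projections u' and v' of u and v, while (u', v') = -4/3.
    Let N be the size of the pillar and m the number of its vertices adjacent to exactly
    one of u and v.  Bessel's inequality gives 4 m <= 128/3 for u' - v', so m <= 10, and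
    4 (N - m) + m <= 48 for u' + v', so 4 N <= 48 + 3 m <= 78. *)

Require Import Defs.
From HB Require Import structures.
From mathcomp Require Import all_boot all_order all_algebra.
From mathcomp Require Import reals.
From mathcomp Require Import complex ring lra zify.

Set Implicit Arguments.
Unset Strict Implicit.
Unset Printing Implicit Defensive.

Import Order.TTheory GRing.Theory Num.Theory.
Local Open Scope ring_scope.

(** * The Rayleigh bound for the smallest eigenvalue *)

Section Rayleigh.
Local Open Scope sesquilinear_scope.

(** Over [R[i]] the spectral theorem diagonalises [S] by a unitary matrix. In the new coordinates
    [y] both forms are sums of [y 0 i * (y 0 i)^*], weighted by the spectral values on one side and
    by [a] on the other, and are compared termwise. *)
Lemma lambda_min_Rayleigh (R : realType) (n : nat) (S : 'M[R]_n) (a : R)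
    (v : 'rV[R]_n) :
  S^T = S -> is_lambda_min S a ->
  a * (v *m v^T) 0 0 <= (v *m S *m v^T) 0 0.
Proof.
move=> symS [_ mina].
pose f := real_complex R.
pose A : 'M[R[i]]_n := map_mx f S.
have fC (b : R) : (f b)^*%R = f b.
  by apply: CrealP; apply/complex_realP; exists b.
have Ah : A \is hermsymmx.
  apply: realsym_hermsym.
    by apply/is_hermitianmxP; rewrite expr0 scale1r map_mx_id // /A map_trmx symS.
  by apply/mxOverP => i j; rewrite mxE; apply/complex_realP; exists (S i j).
have An := hermitian_normalmx Ah.
have dreal := hermitian_spectral_diag_real Ah.
have Au := spectral_unitarymx A.
have /orthomx_spectralP EA := An.
set P := spectralmx A in EA Au.
set d := spectral_diag A in EA dreal.
have Pu : P \in unitmx by apply: unitarymx_unit.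
(* Row [i] of [P] is an eigenvector of [A] for [d 0 i]. This value is real, hence an eigenvalue of
   [S] itself, and the minimality of [a] applies. *)
have da i : f a <= d 0 i.
  have /mxOverP/(_ 0 i)/complex_realP[b db] := dreal.
  rewrite db lecR; apply: mina.
  rewrite -(eigenvalue_map (real_complex R)) -/f -/A.
  apply/eigenvalueP; exists (row i P); last first.
    apply/negP => /eqP Pi0.
    have : row i P *m invmx P = 0 by rewrite Pi0 mul0mx.
    rewrite -row_mul mulmxV // => /rowP/(_ i); rewrite !mxE eqxx => /eqP.
    by rewrite oner_eq0.
  rewrite EA mulmxA mulmxA -row_mul mulmxV // row1 -rowE.
  by rewrite row_diag_mx db -scalemxAl -rowE.
pose w : 'rV[R[i]]_n := map_mx f v.
pose y := w *m invmx P.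
(* The inverse of [P] is its conjugate transpose, and [w] has real entries. *)
have yE : P *m w^T = y ^t*.
  rewrite /y invmx_unitary // trmx_mul map_mxM /= trmxCK.
  congr (_ *m _); apply/matrixP => i j; rewrite !mxE.
  by rewrite fC.
rewrite -lecR.
have -> : ((v *m S *m v^T) 0 0)%:C%C = \sum_i d 0 i * (y 0 i * (y 0 i)^*).
  transitivity ((w *m A *m w^T) 0 0).
    by rewrite /w /A map_trmx -!map_mxM [RHS]mxE.
  rewrite EA !mulmxA -/y -mulmxA yE mxE; apply: eq_bigr => i _.
  by rewrite mul_mx_diag !mxE mulrCA mulrA.
have -> : (a * (v *m v^T) 0 0)%:C%C = \sum_i f a * (y 0 i * (y 0 i)^*).
  rewrite rmorphM -mulr_sumr; congr (_ * _).
  transitivity ((w *m w^T) 0 0).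
    by rewrite /w map_trmx -!map_mxM [RHS]mxE.
  rewrite -[w](mulmxKV Pu) -/y -mulmxA mulmxKV // yE mxE; apply: eq_bigr => i _.
  by rewrite !mxE.
by apply: ler_sum => i _; apply: ler_wpM2r; rewrite ?mul_conjC_ge0.
Qed.

End Rayleigh.

(** * Positive semidefinite forms and Bessel's inequality *)

Definition bform (R : pzRingType) (n : nat) (M : 'M[R]_n) (u v : 'rV[R]_n) : R :=
  (u *m M *m v^T) 0 0.

Section BilinearForm.
Variables (R : realFieldType) (n : nat) (M : 'M[R]_n).
Hypotheses (symM : M^T = M) (psdM : forall v : 'rV[R]_n, 0 <= bform M v v).
Local Notation "''[' u , v ]" := (bform M u v).

Lemma bformC u v : '[u, v] = '[v, u].
Proof.
rewrite /bform -[in RHS](trmxK (v *m M *m u^T)) [in RHS]mxE.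
by rewrite !trmx_mul trmxK symM mulmxA.
Qed.

Lemma bformDl u v w : '[u + v, w] = '[u, w] + '[v, w].
Proof. by rewrite /bform !mulmxDl mxE. Qed.

Lemma bformZl a u w : '[a *: u, w] = a * '[u, w].
Proof. by rewrite /bform -!scalemxAl mxE. Qed.

Lemma bformBl u v w : '[u - v, w] = '[u, w] - '[v, w].
Proof. by rewrite bformDl -scaleN1r bformZl mulN1r. Qed.

Lemma bformBr u v w : '[w, u - v] = '[w, u] - '[w, v].
Proof. by rewrite !(bformC w) bformBl. Qed.

Lemma bformDr u v w : '[w, u + v] = '[w, u] + '[w, v].
Proof. by rewrite !(bformC w) bformDl. Qed.

Lemma bformZr a u w : '[w, a *: u] = a * '[w, u].
Proof. by rewrite !(bformC w) bformZl. Qed.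

Lemma bform_sqrD u v : '[u + v, u + v] = '[u, u] + 2%:R * '[u, v] + '[v, v].
Proof. by rewrite bformDl !bformDr (bformC v u); ring. Qed.

Lemma bform_sqrB u v : '[u - v, u - v] = '[u, u] - 2%:R * '[u, v] + '[v, v].
Proof. by rewrite bformBl !bformBr (bformC v u); ring. Qed.

Lemma bform_suml (I : finType) (P : pred I) (F : I -> 'rV[R]_n) w :
  '[\sum_(i | P i) F i, w] = \sum_(i | P i) '[F i, w].
Proof. by rewrite /bform !mulmx_suml summxE. Qed.

(** This lets coordinate vectors serve as vectors with Gram matrix [M], without factoring [M]. *)
Lemma bform_delta p q : '[delta_mx 0 p, delta_mx 0 q] = M p q.
Proof. by rewrite /bform -rowE trmx_delta -colE !mxE. Qed.

(** With [y] the sum of the ['[z, w p] *: w p] and [s] the left-hand side, the form at [c *: z - y]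
    equals [c * (c * '[z, z] - s)]. It is nonnegative, and [c] is positive. *)
Lemma Bessel (I : finType) (P : {set I}) (w : I -> 'rV[R]_n) (c : R) z :
    0 < c -> (forall p q, p \in P -> q \in P -> '[w p, w q] = c *+ (p == q)) ->
  \sum_(p in P) '[z, w p] ^+ 2 <= c * '[z, z].
Proof.
move=> c0 orth; set s := \sum_(p in P) _.
pose y := \sum_(p in P) '[z, w p] *: w p.
have zy : '[z, y] = s.
  rewrite bformC bform_suml; apply: eq_bigr => p _.
  by rewrite bformZl bformC -expr2.
have yy : '[y, y] = c * s.
  rewrite {1}/y bform_suml mulr_sumr; apply: eq_bigr => p pP.
  rewrite bformZl (bformC (w p)) bform_suml (bigD1 p) //= big1.
    by rewrite bformZl orth // eqxx mulr1n addr0; ring.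
  by move=> q /andP[qP /negPf qp]; rewrite bformZl orth // qp mulr0n mulr0.
have := psdM (c *: z - y).
rewrite bformBl !bformBr !bformZl !bformZr (bformC y z) zy yy.
have -> : c * (c * '[z, z]) - c * s - (c * s - c * s) = c * (c * '[z, z] - s) by ring.
by rewrite pmulr_rge0 // subr_ge0.
Qed.

End BilinearForm.

(** * Switching: cliques and semidefiniteness *)

Section Switching.
Variables (R : realType) (n : nat).
Implicit Types (S : 'M[R]_n) (U A : {set 'I_n}).

Definition switching_sign U (a : 'I_n) : R := if a \in U then 1 else -1.

Lemma switching_sign_sqr U a : switching_sign U a * switching_sign U a = 1.
Proof. by rewrite /switching_sign; case: ifP; rewrite ?mulrNN mulr1. Qed.

Lemma switching_mxE S U a b :
  (switching_mx R U *m S *m switching_mx R U) a b =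
  switching_sign U a * S a b * switching_sign U b.
Proof. by rewrite mul_mx_diag mul_diag_mx !mxE. Qed.

(** Send the vertices of [U] to the first copy and the others to the second. The off-diagonal blocks
    carry [- S], which is the sign change made by switching; the added identity only concerns a
    vertex and its own copy, so it does not affect distinct vertices. *)
Lemma clique_switching S U A :
    clique (seidel_graph (switching_mx R U *m S *m switching_mx R U)) A ->
  (#|A| <= switching_clique_number S)%N.
Proof.
move=> /forall_inP cA.
pose g a := if a \in U then lshift n a else rshift n a.
have ginj : injective g.
  move=> a b; rewrite /g; case: ifP => _; case: ifP => _ /eqP.
  - by rewrite eq_lshift => /eqP.
  - by rewrite eq_lrshift.
  - by rewrite eq_rlshift.
  - by rewrite eq_rshift => /eqP.
rewrite -(card_imset (mem A) ginj).
apply: (leq_bigmax_cond (F := fun A : {set 'I_(n + n)} => #|A|)).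
apply/forall_inP => _ /imsetP[a aA ->]; apply/forall_inP => _ /imsetP[b bA ->].
apply/implyP => /eqP gab; have /negPf ab : a != b by apply/eqP => E; apply: gab; rewrite E.
have /forall_inP/(_ _ bA) := cA _ aA; rewrite ab /= /seidel_graph switching_mxE.
rewrite /switching_graph /seidel_graph /g /switching_sign.
case: ifP => _; case: ifP => _; rewrite ?block_mxEul ?block_mxEur ?block_mxEdl ?block_mxEdr;
  by rewrite ?mxE ?ab ?mulr0n ?addr0 ?mulN1r ?mulrN1 ?mul1r ?mulr1 ?opprK.
Qed.

(** The switching matrix squares to the identity, so this is the Rayleigh bound for [S] at
    [v *m switching_mx R U]. *)
Lemma switching_shift_ge0 S U a v :
    S^T = S -> is_lambda_min S (- a) ->
  0 <= bform (switching_mx R U *m S *m switching_mx R U + a%:M) v v.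
Proof.
move=> symS minS; have := lambda_min_Rayleigh (v *m switching_mx R U) symS minS.
have DD : switching_mx R U *m switching_mx R U = 1%:M.
  apply/matrixP => i j; rewrite mul_diag_mx !mxE.
  case: eqP => [->|_]; last by rewrite mulr0n mulr0.
  by rewrite mulr1n; apply: switching_sign_sqr.
rewrite trmx_mul tr_diag_mx -/(switching_mx R U) !mulmxA -(mulmxA v) DD mulmx1.
rewrite -subr_ge0 mulNr opprK => vSv; rewrite /bform mulmxDr mulmxDl mxE.
by rewrite mul_mx_scalar -scalemxAl [X in _ + X]mxE !mulmxA.
Qed.

End Switching.

(** * Pillars over a single base vertex *)

Section Pillars.
Variables (T : finType) (e : rel T) (x : 'I_4 -> T).
Hypothesis xinj : injective x.
Let B := [set x i | i : 'I_4].

Lemma pillar1P t p :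
  reflect (p \notin B /\ forall m, e p (x m) = (m == t)) (p \in pillar e B [set x t]).
Proof.
rewrite inE; apply: (iffP and3P) => [[pB /forall_inP adj /forall_inP nadj]|[pB pE]].
  split=> // m; case: eqP => [->|/eqP mt]; first by apply: adj; rewrite inE.
  by apply/negbTE/nadj; rewrite !inE (inj_eq xinj) mt imset_f.
split=> //; apply/forall_inP => y.
  by rewrite inE => /eqP ->; rewrite pE.
by rewrite !inE => /andP[yt /imsetP[m _ ym]]; rewrite ym pE -(inj_eq xinj) -ym.
Qed.

End Pillars.

(** * Gram computations and the bound 19 *)

Section PillarBound.
Variables (R : realFieldType) (n : nat) (e : rel 'I_n) (M : 'M[R]_n).
Hypotheses (symM : M^T = M) (psdM : forall v : 'rV[R]_n, 0 <= bform M v v).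
Hypotheses (diagM : forall a, M a a = 5%:R)
  (offM : forall a b, a != b -> M a b = if e a b then -1 else 1).
Variables (x : 'I_4 -> 'I_n).
Hypothesis xinj : injective x.
Let B := [set x m | m : 'I_4].
Hypothesis cliqueB : clique e B.
Local Notation "''[' u , v ]" := (bform M u v).
Local Notation P t := (pillar e B [set x t]).
Local Notation d a := (delta_mx 0 a : 'rV[R]_n).

Lemma gram_base s t : M (x s) (x t) = if s == t then 5%:R else -1.
Proof.
case: eqP => [->|/eqP st]; first exact: diagM.
rewrite offM ?(inj_eq xinj) //.
have xB m : x m \in B by apply: imset_f.
have /forall_inP/(_ _ (xB s))/forall_inP/(_ _ (xB t)) := cliqueB.
by rewrite (inj_eq xinj) st /= => ->.
Qed.

Lemma gram_pillar t p m : p \in P t -> M p (x m) = if m == t then -1 else 1.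
Proof.
move=> /(pillar1P e xinj)[pB pE]; rewrite offM ?pE //.
by apply: contraNneq pB => ->; apply: imset_f.
Qed.

Let X := \sum_m d (x m).

(** The base has Gram matrix [6 I - J] of order 4, for which the all-ones vector has eigenvalue
    [6 - 4 = 2]. *)
Lemma bform_base m : '[X, d (x m)] = 2%:R.
Proof.
rewrite bform_suml (bigD1 m) //= bform_delta gram_base eqxx.
rewrite (eq_bigr (fun=> -1)) => [|s sm].
  by rewrite sumr_const cardC1 card_ord /=; ring.
by rewrite bform_delta gram_base (negPf sm).
Qed.

Lemma bform_base_base : '[X, X] = 8%:R.
Proof.
rewrite bform_suml (eq_bigr (fun=> 2%:R)) => [|m _].
  by rewrite sumr_const card_ord; ring.
by rewrite bformC // bform_base.
Qed.

Lemma bform_base_pillar t p : p \in P t -> '[X, d p] = 2%:R.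
Proof.
move=> pP; rewrite bform_suml (bigD1 t) //= bformC // bform_delta (gram_pillar _ pP) eqxx.
rewrite (eq_bigr (fun=> 1)) => [|s st].
  by rewrite sumr_const cardC1 card_ord /=; ring.
by rewrite bformC // bform_delta (gram_pillar _ pP) (negPf st).
Qed.

(* The component of [p \in P t] orthogonal to the base. *)
Let r t p := d p - 3%:R^-1 *: (X - d (x t)).

(** The vector subtracted in [r t q] has inner product [(2 - 5) / 3 = -1] with [x t] and
    [(2 + 1) / 3 = 1] with the other base vertices, exactly as [q] does, so it is the projection of
    [q] to the base. The correction is its inner product with [p]: [(2 + 1) / 3] if [s = t], and
    [(2 - 1) / 3] otherwise. *)
Lemma bform_pillar s t p q : p \in P s -> q \in P t ->
  '[r s p, r t q] = M p q - (if s == t then 1 else 3%:R^-1).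
Proof.
move=> pP qP; rewrite /r !(bformBl, bformBr, bformZl, bformZr) //.
rewrite !(bformC symM (d _) X) (bform_base_pillar pP) (bform_base_pillar qP).
rewrite !bform_base bform_base_base (bformC symM (d (x s)) (d q)) !bform_delta gram_base.
rewrite (gram_pillar _ pP) (gram_pillar _ qP) eq_sym.
by case: eqP => _; field.
Qed.

Lemma card_pillar_le19 i j k u v :
    i != j -> k != i -> k != j -> u \in P i -> v \in P j -> e u v ->
    {in P k &, forall p q, p != q -> ~~ e p q} ->
  (#|P k| <= 19)%N.
Proof.
move=> ij ki kj uP vP uv indep.
have P_neq s t p q : s != t -> p \in P s -> q \in P t -> p != q.
  move=> st /(pillar1P e xinj)[_ pE] /(pillar1P e xinj)[_ qE].
  by apply: contra_neq st => pq; apply/eqP; rewrite -qE -pq pE.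
have orth p q : p \in P k -> q \in P k -> '[r k p, r k q] = 4%:R *+ (p == q).
  move=> pP qP; rewrite (bform_pillar pP qP) eqxx.
  case: eqVneq => [->|pq]; first by rewrite diagM mulr1n; ring.
  by rewrite offM // (negPf (indep _ _ pP qP pq)) mulr0n subrr.
have uu : '[r i u, r i u] = 4%:R.
  by rewrite (bform_pillar uP uP) eqxx diagM; ring.
have vv : '[r j v, r j v] = 4%:R.
  by rewrite (bform_pillar vP vP) eqxx diagM; ring.
have uvE : '[r i u, r j v] = - 4%:R / 3%:R.
  by rewrite (bform_pillar uP vP) (negPf ij) offM ?uv ?(P_neq i j) //; field.
have rE s w p : s != k -> w \in P s -> p \in P k ->
    '[r s w, r k p] = (if e w p then - 4%:R / 3%:R else 2%:R / 3%:R).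
  move=> sk wP pP; rewrite (bform_pillar wP pP) (negPf sk) offM ?(P_neq s k) //.
  by case: ifP => _; field.
rewrite eq_sym in ki; rewrite eq_sym in kj.
have c0 : (0 : R) < 4%:R by rewrite ltr0n.
have plus := Bessel symM psdM (r i u + r j v) c0 orth.
have minus := Bessel symM psdM (r i u - r j v) c0 orth.
rewrite bform_sqrD // uu vv uvE in plus.
rewrite bform_sqrB // uu vv uvE in minus.
(* On [Q] the difference of the projections of [u] and [v] has inner product 2 or -2 with [r k p],
   and their sum has -2/3. Off [Q] the sum has 4/3 or -8/3, of square at least 16/9. *)
pose Q := [set p in P k | e u p (+) e v p].
have QP : Q \subset P k by apply/subsetP => p; rewrite inE => /andP[].
rewrite -(cardsID Q) (setIidPr QP).
have Q10 : (#|Q| <= 10)%N.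
  have {plus} : \sum_(p in Q) (4%:R : R) <= 128%:R / 3%:R.
    apply: (@le_trans _ _ (4%:R * (4%:R - 2%:R * (- 4%:R / 3%:R) + 4%:R))); last first.
      by rewrite le_eqVlt; apply/orP; left; apply/eqP; field.
    apply: le_trans minus; rewrite big_mkcond [X in _ <= X]big_mkcond /=.
    apply: ler_sum => p _; rewrite inE; case: ifP => [/andP[pP]|_].
      rewrite pP bformBl (rE _ _ _ ki uP pP) (rE _ _ _ kj vP pP).
      by case: (e u p); case: (e v p) => // _; lra.
    by case: ifP => // _; apply: sqr_ge0.
  rewrite sumr_const -[4%:R *+ _]mulr_natr -natrM => h.
  (* Clearing the denominator gives an inequality of naturals, [12 #|Q| <= 128], to which integer
     rounding applies. *)
  have : (((4 * #|Q|) * 3)%N%:R : R) <= 128%:R by rewrite natrM; lra.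
  by rewrite ler_nat; lia.
have : 4%:R / 9%:R * #|Q|%:R + 16%:R / 9%:R * #|P k :\: Q|%:R <= (64%:R / 3%:R : R).
  apply: (@le_trans _ _ (4%:R * (4%:R + 2%:R * (- 4%:R / 3%:R) + 4%:R))); last first.
    by rewrite le_eqVlt; apply/orP; left; apply/eqP; field.
  apply: le_trans plus; rewrite (big_setID Q) /= (setIidPr QP) !mulr_natr -!sumr_const.
  apply: lerD; apply: ler_sum => p.
    rewrite inE => /andP[pP]; rewrite bformDl (rE _ _ _ ki uP pP) (rE _ _ _ kj vP pP).
    by case: (e u p); case: (e v p) => // _; lra.
  rewrite in_setD inE => /andP[+ pP].
  rewrite bformDl (rE _ _ _ ki uP pP) (rE _ _ _ kj vP pP) pP.
  by case: (e u p); case: (e v p) => // _; lra.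
(* This is [h] times 9/4. Adding [3 #|Q| <= 30] bounds four times the size of the pillar by 78. *)
move=> h; have : ((#|Q| + 4 * #|P k :\: Q|)%N%:R : R) <= 48%:R by rewrite natrD natrM; lra.
by rewrite ler_nat; lia.
Qed.

End PillarBound.

(** * Independence of the pillar, and conclusion *)

Section SwitchedGraph.
Variables (R : realType) (n : nat) (S : 'M[R]_n) (U : {set 'I_n}) (e : rel 'I_n).
Hypotheses (hS : seidel S)
  (eE : e =2 seidel_graph (switching_mx R U *m S *m switching_mx R U)).
Let N := switching_mx R U *m S *m switching_mx R U.

Lemma switched_sym : N^T = N.
Proof. by case: hS => symS _ _; rewrite /N !trmx_mul tr_diag_mx symS mulmxA. Qed.

Lemma switched_diag a : N a a = 0.
Proof. by case: hS => _ S0 _; rewrite switching_mxE S0 mulr0 mul0r. Qed.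

Lemma switched_offdiag a b : a != b -> N a b = if e a b then -1 else 1.
Proof.
move=> ab; rewrite eE /seidel_graph -/N; case: eqP => // /eqP.
case: hS => _ _ /(_ _ _ ab) Sab; rewrite switching_mxE /switching_sign.
by case: Sab => ->; case: ifP; case: ifP => _ _;
  rewrite ?(mul1r, mulr1, mulN1r, mulrN1, opprK) ?eqxx.
Qed.

Lemma switched_symm a b : e a b = e b a.
Proof. by rewrite !eE /seidel_graph -/N -{1}switched_sym mxE. Qed.

(** Switching with respect to [B] exchanges edges and non-edges between [B] and its complement, so
    [p] and [q] become adjacent to the three base vertices other than [x k]. An edge between [p] and
    [q] would complete a 5-clique. *)
Lemma pillar1_independent (x : 'I_4 -> 'I_n) k :
    injective x -> (switching_clique_number S <= 4)%N ->
    clique e [set x i | i : 'I_4] ->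
  {in pillar e [set x i | i : 'I_4] [set x k] &, forall p q, p != q -> ~~ e p q}.
Proof.
set B := [set x i | i : 'I_4] => xinj w4 cB p q.
move=> /(pillar1P e xinj)[pB pE] /(pillar1P e xinj)[qB qE] pq; apply/negP => epq.
pose A := p |: (q |: B :\ x k).
(* Switching composes by symmetric difference: [S] switched by [W] is [N] switched by [B], which
   puts the new clique in the switching class of [S]. *)
pose W := [set a | (a \in U) (+) (a \in B)].
have xB m : x m \in B by apply: imset_f.
have BA a : a \in B :\ x k -> exists2 m, m != k & a = x m.
  rewrite in_setD1 => /andP[ak /imsetP[m _ am]]; exists m => //.
  by apply: contra_neq ak => <-.
suff cA : clique (seidel_graph (switching_mx R W *m S *m switching_mx R W)) A.
  have := leq_trans (clique_switching cA) w4.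
  rewrite /A !cardsU1 !inE (negPf pq) (negPf pB) (negPf qB) !andbF /= => c5.
  have B4 : #|B| = 4 by rewrite card_imset // card_ord.
  have BD : #|B :\ x k| = 3.
    by apply/eqP; rewrite -(eqn_add2l (x k \in B)) -cardsD1 xB B4.
  by rewrite BD in c5.
have NW a b : (switching_mx R W *m S *m switching_mx R W) a b =
    (if (a \in B) (+) (b \in B) then - N a b else N a b).
  rewrite !switching_mxE /switching_sign !inE.
  by do 2![case: (_ \in U); case: (_ \in B)] => /=;
    rewrite ?(mul1r, mulr1, mulN1r, mulrN1, opprK).
apply/forall_inP => a aA; apply/forall_inP => b bA; apply/implyP => ab.
rewrite /seidel_graph NW (switched_offdiag ab).
move: aA bA; rewrite !in_setU1.
case/or3P => [/eqP aE | /eqP aE | /BA[m mk aE]];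
  case/or3P => [/eqP bE | /eqP bE | /BA[m' mk' bE]]; subst a b.
- by rewrite eqxx in ab.
- by rewrite (negPf pB) (negPf qB) epq.
- by rewrite (negPf pB) xB pE (negPf mk').
- by rewrite (negPf pB) (negPf qB) switched_symm epq.
- by rewrite eqxx in ab.
- by rewrite (negPf qB) xB qE (negPf mk').
- by rewrite (negPf pB) xB switched_symm pE (negPf mk).
- by rewrite (negPf qB) xB switched_symm qE (negPf mk).
- have /forall_inP/(_ _ (xB m))/forall_inP/(_ _ (xB m'))/implyP/(_ ab) -> := cB.
  by rewrite !xB.
Qed.

End SwitchedGraph.

Theorem theorem8p1 (R : realType) (n : nat) (S : 'M[R]_n)
    (hS : seidel S) (hmin : is_lambda_min S (- 5%:R))
    (hw : switching_clique_number S = 4%N)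
    (G : rel 'I_n) (hG : switching_class S G) (hwG : clique_number G = 4%N)
    (x : 'I_4 -> 'I_n) (hx : injective x)
    (B : {set 'I_n}) (hB : B = [set x i | i : 'I_4]) (hBc : clique G B)
    (i j : 'I_4) (hij : i != j)
    (huv : exists u v : 'I_n, [/\ u \in pillar G B [set x i],
                                  v \in pillar G B [set x j] & G u v])
    (k : 'I_4) (hki : k != i) (hkj : k != j) :
  (#|pillar G B [set x k]| <= 19)%N.
Proof.
move: huv => [u [v [uP vP uv]]]; subst B; case: hG => U GE.
pose N := switching_mx R U *m S *m switching_mx R U.
(* The shift 5 is the negative of the smallest eigenvalue, so the shifted matrix is semidefinite. *)
apply: (@card_pillar_le19 R n G (N + 5%:R%:M)) uP vP uv _ => //.
- by rewrite linearD /= tr_scalar_mx switched_sym.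
- by move=> w; apply: switching_shift_ge0 => //; case: hS.
- by move=> a; rewrite mxE switched_diag // mxE eqxx add0r.
- move=> a b ab; rewrite mxE (switched_offdiag hS GE ab) mxE (negPf ab).
  by rewrite mulr0n addr0.
- by apply: (pillar1_independent hS GE) => //; rewrite hw.
Qed.
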